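(* Vinberg's scroll model $Y_{\mathrm V}^{\min}$, with parameters $a,a_1,a_2,b,b_1,b_2,f_1,f_2,g_1,g_2,h\in\mathbb C$, is birational to the Weierstrass model $$y^2=x^3+(u^3+F_4u+F_6)x^2+(G_8u^2+G_{10}u+G_{12})x+H_8u^5+H_{10}u^4+H_{12}u^3+H_{14}u^2+H_{16}u+H_{18},$$ where the explicit relation between Vinberg's coefficients and those of the Weierstrass model is $$\begin{aligned} &F_4=-\tfrac32a_2,\quad F_6=-\tfrac32f_2,\quad G_8=f_1+\tfrac34a_2^2,\quad G_{10}=a_1+\tfrac32a_2f_2,\quad G_{12}=a+\tfrac34f_2^2,\\ &H_8=b_2-\tfrac14a_2^2,\quad H_{10}=g_2-\tfrac12a_2f_2,\quad H_{12}=h-\tfrac12a_2f_1-\tfrac14f_2^2-\tfrac18a_2^3,\\ &H_{14}=g_1-\tfrac12(a_2a_1+f_2f_1)-\tfrac38a_2^2f_2,\quad H_{16}=b_1-\tfrac12(a_2a+f_2a_1)-\tfrac38a_2f_2^2,\\ &H_{18}=b-\tfrac12f_2a-\tfrac18f_2^3. \end{aligned}$$ In particular, $H_8=-\tfrac14(a_2^2-4b_2)$.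
   Context: Let $\mathcal S_{\mathrm{sc}}=\mathcal S(0,1,2)\subset\mathbb P^5$ be the singular rational normal scroll with homogeneous coordinates $(x_0,x_1,x_2,y_1,y_2,z)$ and ideal generated by $x_2y_1-x_1z$, $x_1y_2-x_2z$, $y_1y_2-z^2$. Vinberg's canonical cubic and its satellite cubic are $$\begin{aligned}\mathcal F={}&x_0^2y_1+x_1^3+x_2^2z+(ax_1+by_1)y_1^2+(a_1x_1y_1+a_2x_2y_2+b_1y_1^2+b_2y_2^2)z\\&+(f_1x_1+f_2x_2+g_1y_1+g_2y_2+hz)z^2,\\ \widetilde{\mathcal F}={}&x_0^2z+x_1^2x_2+(x_2^2+a_2x_2y_2+b_2y_2^2)y_2+(ax_1+by_1)y_1z+(f_2x_2+g_2y_2)y_2z\\&+(a_1x_1+f_1x_2+b_1y_1+hy_2+g_1z)z^2.\end{aligned}$$ The degree-eight surface $Y_{\mathrm V}\subset\mathcal S_{\mathrm{sc}}$ is defined inside the scroll by $\mathcal F=\widetilde{\mathcal F}=0$, and $Y_{\mathrm V}^{\min}$ denotes its minimal resolution; the parameters are taken such that $Y_{\mathrm V}^{\min}$ is a K3 surface. *)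

(* Defs.v *)
From HB Require Import structures.
From mathcomp Require Import all_boot all_order all_algebra.
From mathcomp Require Import complex reals mpoly.

Set Implicit Arguments.
Unset Strict Implicit.
Unset Printing Implicit Defensive.

Import Order.TTheory GRing.Theory Num.Theory.
Local Open Scope ring_scope.

(* Points of P^n are handled through their homogeneous coordinates: a subset of
   P^n is given by the set of nonzero vectors of K^(n+1) representing its
   points, and equality of points is [proj_eq]. *)
Definition pset (K : closedFieldType) (n : nat) : Type := 'rV[K]_n.+1 -> Prop.

Definition proj_eq (K : closedFieldType) (n : nat) (v w : 'rV[K]_n.+1) : Prop :=
  exists2 c : K, c != 0 & w = c *: v.

Definition homogeneous (K : closedFieldType) (n : nat) (p : {mpoly K[n.+1]}) : Prop :=
  exists d : nat, p \is d.-homog.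

(** * The Zariski topology *)

Definition zclosed (K : closedFieldType) (n : nat) (Z : pset K n) : Prop :=
  exists s : seq {mpoly K[n.+1]},
    (forall p, p \in s -> homogeneous p) /\
    (forall v, Z v <-> v != 0 /\ forall p, p \in s -> p.@[v 0] = 0).

Definition zopen_in (K : closedFieldType) (n : nat) (X U : pset K n) : Prop :=
  exists2 Z : pset K n, zclosed Z & forall v, U v <-> X v /\ ~ Z v.

Definition zdense_in (K : closedFieldType) (n : nat) (X U : pset K n) : Prop :=
  forall Z : pset K n, zclosed Z ->
    (forall v, U v -> Z v) -> forall v, X v -> Z v.

Definition zirreducible (K : closedFieldType) (n : nat) (X : pset K n) : Prop :=
  (exists v, X v) /\
  forall Z1 Z2 : pset K n, zclosed Z1 -> zclosed Z2 ->
    (forall v, X v -> Z1 v \/ Z2 v) ->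
    (forall v, X v -> Z1 v) \/ (forall v, X v -> Z2 v).

Definition projective_variety (K : closedFieldType) (n : nat) (X : pset K n) : Prop :=
  zclosed X /\ zirreducible X.

Definition has_chain (K : closedFieldType) (n : nat) (X : pset K n) (d : nat) : Prop :=
  exists Z : nat -> pset K n,
    (forall i, (i <= d)%N -> projective_variety (Z i) /\ forall v, Z i v -> X v) /\
    (forall i, (i < d)%N ->
       (forall v, Z i v -> Z i.+1 v) /\ exists2 v, Z i.+1 v & ~ Z i v).

Definition has_dim (K : closedFieldType) (n : nat) (X : pset K n) (d : nat) : Prop :=
  has_chain X d /\ ~ has_chain X d.+1.

(** * Regular functions and regular maps *)

Definition regular_fun (K : closedFieldType) (n : nat) (X : pset K n)
    (f : 'rV[K]_n.+1 -> K) : Prop :=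
  forall v, X v -> exists U : pset K n, zopen_in X U /\ U v /\
    exists (d : nat) (P Q : {mpoly K[n.+1]}),
      P \is d.-homog /\ Q \is d.-homog /\
      forall w, U w -> Q.@[w 0] != 0 /\ f w = P.@[w 0] / Q.@[w 0].

Definition eval_map (K : closedFieldType) (n m : nat)
    (P : 'I_m.+1 -> {mpoly K[n.+1]}) (v : 'rV[K]_n.+1) : 'rV[K]_m.+1 :=
  \row_i (P i).@[v 0].

(* [f] picks one coordinate vector for each image point; only its class modulo
   [proj_eq] is relevant. *)
Definition regular_map (K : closedFieldType) (n m : nat) (X : pset K n) (Y : pset K m)
    (f : 'rV[K]_n.+1 -> 'rV[K]_m.+1) : Prop :=
  (forall v, X v -> Y (f v)) /\
  forall v, X v -> exists U : pset K n, zopen_in X U /\ U v /\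
    exists (d : nat) (P : 'I_m.+1 -> {mpoly K[n.+1]}),
      (forall i, P i \is d.-homog) /\
      forall w, U w -> eval_map P w != 0 /\ proj_eq (f w) (eval_map P w).

Definition mutually_inverse (K : closedFieldType) (n m : nat) (X : pset K n) (Y : pset K m)
    (f : 'rV[K]_n.+1 -> 'rV[K]_m.+1) (g : 'rV[K]_m.+1 -> 'rV[K]_n.+1) : Prop :=
  [/\ regular_map X Y f, regular_map Y X g,
      forall v, X v -> proj_eq v (g (f v)) & forall w, Y w -> proj_eq w (f (g w))].

Definition birational (K : closedFieldType) (n m : nat) (X : pset K n) (Y : pset K m) : Prop :=
  exists (U : pset K n) (V : pset K m) f g,
    [/\ zopen_in X U, zdense_in X U, zopen_in Y V, zdense_in Y V & mutually_inverse U V f g].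

Definition birational_morphism (K : closedFieldType) (n m : nat) (X : pset K n) (Y : pset K m)
    (f : 'rV[K]_n.+1 -> 'rV[K]_m.+1) : Prop :=
  regular_map X Y f /\
  exists (U : pset K n) (V : pset K m) g,
    [/\ zopen_in X U, zdense_in X U, zopen_in Y V, zdense_in Y V & mutually_inverse U V f g].

(** * Smoothness and minimal resolutions *)

(* Tangent space at [v] of the affine cone over [X]. The tangent space of [X]
   at the corresponding point is its quotient by the line spanned by [v]. *)
Definition cone_tangent (K : closedFieldType) (n : nat) (X : pset K n)
    (v w : 'rV[K]_n.+1) : Prop :=
  forall p : {mpoly K[n.+1]}, homogeneous p -> (forall u, X u -> p.@[u 0] = 0) ->
    \sum_i (p^`M(i)).@[v 0] * w 0 i = 0.

Definition smooth_projective_variety (K : closedFieldType) (n : nat) (X : pset K n)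
    (d : nat) : Prop :=
  [/\ projective_variety X, has_dim X d &
      forall v, X v -> exists T : {vspace 'rV[K]_n.+1},
        (forall w, w \in T <-> cone_tangent X v w) /\ \dim T = d.+1].

Definition resolution (K : closedFieldType) (n m : nat) (Y : pset K m) (X : pset K n)
    (pi : 'rV[K]_n.+1 -> 'rV[K]_m.+1) : Prop :=
  (exists d, smooth_projective_variety X d) /\ birational_morphism X Y pi.

(* For surfaces every resolution is projective, so it suffices to test the
   universal property on projective ones. *)
Definition minimal_resolution (K : closedFieldType) (n m : nat) (Y : pset K m) (X : pset K n)
    (pi : 'rV[K]_n.+1 -> 'rV[K]_m.+1) : Prop :=
  resolution Y X pi /\
  forall (n' : nat) (X' : pset K n') (pi' : 'rV[K]_n'.+1 -> 'rV[K]_m.+1),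
    resolution Y X' pi' ->
    exists h, regular_map X' X h /\ forall v, X' v -> proj_eq (pi' v) (pi (h v)).

(** * K3 surfaces *)

(* A regular 2-form on [X] is given by its pullback to the affine cone: locally
   it is the form sum_(i,j) (A_ij / B) dx_i /\ dx_j, of total degree 0, and its
   contraction with the Euler vector field vanishes. *)
Definition regular_two_form (K : closedFieldType) (n : nat) (X : pset K n)
    (omega : 'rV[K]_n.+1 -> 'rV[K]_n.+1 -> 'rV[K]_n.+1 -> K) : Prop :=
  (forall v w, X v -> cone_tangent X v w -> omega v v w = 0) /\
  forall v, X v -> exists U : pset K n, zopen_in X U /\ U v /\
    exists (d : nat) (A : 'I_n.+1 -> 'I_n.+1 -> {mpoly K[n.+1]}) (B : {mpoly K[n.+1]}),
      (forall i j, A i j \is d.-homog) /\ B \is d.+2.-homog /\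
      forall u, U u -> B.@[u 0] != 0 /\
        forall w w', cone_tangent X u w -> cone_tangent X u w' ->
          omega u w w' =
            (\sum_i \sum_j (A i j).@[u 0] * (w 0 i * w' 0 j - w 0 j * w' 0 i)) / B.@[u 0].

(* For a smooth surface, omega_X is trivial iff it has a nowhere vanishing
   global section. *)
Definition trivial_canonical_bundle (K : closedFieldType) (n : nat) (X : pset K n) : Prop :=
  exists2 omega, regular_two_form X omega &
    forall v, X v -> exists w w',
      [/\ cone_tangent X v w, cone_tangent X v w' & omega v w w' != 0].

Definition std_chart (K : closedFieldType) (n : nat) (X : pset K n) (i : 'I_n.+1) : pset K n :=
  fun v => X v /\ v 0 i != 0.

(* H^1(X, O_X) = 0, as Cech cohomology of the standard affine cover. *)
Definition H1_structure_sheaf_zero (K : closedFieldType) (n : nat) (X : pset K n) : Prop :=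
  forall phi : 'I_n.+1 -> 'I_n.+1 -> 'rV[K]_n.+1 -> K,
    (forall i j, regular_fun (fun v => std_chart X i v /\ std_chart X j v) (phi i j)) ->
    (forall i j k v, std_chart X i v -> std_chart X j v -> std_chart X k v ->
       phi i j v + phi j k v = phi i k v) ->
    exists psi : 'I_n.+1 -> 'rV[K]_n.+1 -> K,
      (forall i, regular_fun (std_chart X i) (psi i)) /\
      (forall i j v, std_chart X i v -> std_chart X j v ->
         phi i j v = psi j v - psi i v).

Definition K3_surface (K : closedFieldType) (n : nat) (X : pset K n) : Prop :=
  [/\ smooth_projective_variety X 2, trivial_canonical_bundle X & H1_structure_sheaf_zero X].

(** * Vinberg's scroll model *)

(* Homogeneous coordinates (x0, x1, x2, y1, y2, z) on P^5. *)
Definition scroll (K : closedFieldType) : pset K 5 := fun v =>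
  let x1 := v 0 1 in let x2 := v 0 2 in
  let y1 := v 0 3 in let y2 := v 0 4 in let z := v 0 5 in
  [/\ v != 0, x2 * y1 - x1 * z = 0, x1 * y2 - x2 * z = 0 & y1 * y2 - z ^+ 2 = 0].

Definition vinberg_cubic (K : closedFieldType) (a a1 a2 b b1 b2 f1 f2 g1 g2 h : K)
    (v : 'rV[K]_6) : K :=
  let x0 := v 0 0 in let x1 := v 0 1 in let x2 := v 0 2 in
  let y1 := v 0 3 in let y2 := v 0 4 in let z := v 0 5 in
  x0 ^+ 2 * y1 + x1 ^+ 3 + x2 ^+ 2 * z + (a * x1 + b * y1) * y1 ^+ 2
  + (a1 * x1 * y1 + a2 * x2 * y2 + b1 * y1 ^+ 2 + b2 * y2 ^+ 2) * z
  + (f1 * x1 + f2 * x2 + g1 * y1 + g2 * y2 + h * z) * z ^+ 2.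

Definition satellite_cubic (K : closedFieldType) (a a1 a2 b b1 b2 f1 f2 g1 g2 h : K)
    (v : 'rV[K]_6) : K :=
  let x0 := v 0 0 in let x1 := v 0 1 in let x2 := v 0 2 in
  let y1 := v 0 3 in let y2 := v 0 4 in let z := v 0 5 in
  x0 ^+ 2 * z + x1 ^+ 2 * x2 + (x2 ^+ 2 + a2 * x2 * y2 + b2 * y2 ^+ 2) * y2
  + (a * x1 + b * y1) * y1 * z + (f2 * x2 + g2 * y2) * y2 * z
  + (a1 * x1 + f1 * x2 + b1 * y1 + h * y2 + g1 * z) * z ^+ 2.

Definition vinberg_surface (K : closedFieldType) (a a1 a2 b b1 b2 f1 f2 g1 g2 h : K) :
    pset K 5 := fun v =>
  [/\ scroll v, vinberg_cubic a a1 a2 b b1 b2 f1 f2 g1 g2 h v = 0 &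
      satellite_cubic a a1 a2 b b1 b2 f1 f2 g1 g2 h v = 0].

(** * Weierstrass models *)

(* The image of a subset of affine n-space in P^n under t |-> [1 : t]. *)
Definition affine_chart (K : closedFieldType) (n : nat) (S : 'rV[K]_n -> Prop) : pset K n :=
  fun v => v 0 ord0 != 0 /\ S (\row_i (v 0 (lift ord0 i) / v 0 ord0)).

(* Affine coordinates (x, y, u). *)
Definition weierstrass_model (K : closedFieldType)
    (F4 F6 G8 G10 G12 H8 H10 H12 H14 H16 H18 : K) : pset K 3 :=
  affine_chart (fun t : 'rV[K]_3 =>
    let x := t 0 0 in let y := t 0 1 in let u := t 0 2 in
    y ^+ 2 = x ^+ 3 + (u ^+ 3 + F4 * u + F6) * x ^+ 2
             + (G8 * u ^+ 2 + G10 * u + G12) * x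
             + H8 * u ^+ 5 + H10 * u ^+ 4 + H12 * u ^+ 3 + H14 * u ^+ 2 + H16 * u + H18).

(* Main.v *)
Require Import Defs.
From HB Require Import structures.
From mathcomp Require Import all_boot all_order all_algebra.
From mathcomp Require Import complex reals mpoly.
From mathcomp Require Import ring.
From mathcomp Require boolp.

Set Implicit Arguments.
Unset Strict Implicit.
Unset Printing Implicit Defensive.

Import Order.TTheory GRing.Theory Num.Theory.
Local Open Scope ring_scope.

(** On the chart y1 <> 0 of the scroll, scale y1 to 1 and write u = z; the scroll
    equations give x2 = u x1 and y2 = u^2, so the chart is an affine 3-space with
    coordinates (x0, x1, u). There the satellite cubic is u times Vinberg's
    cubic, and the latter reads
      x0^2 + x1^3 + u^3 x1^2 + (a2 u^4 + f2 u^3 + f1 u^2 + a1 u + a) x1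
        + b2 u^5 + g2 u^4 + h u^3 + g1 u^2 + b1 u + b = 0.
    Setting x0 = i y turns x0^2 into - y^2, and the translation
    x1 = x - (a2 u + f2) / 2 is the one that kills the terms u^4 x and u^3 x;
    what is left is the Weierstrass equation, with the stated coefficients. Thus
    the chart of the surface is isomorphic, by explicit homogeneous polynomials,
    to the whole affine Weierstrass model ([vinberg_weierstrass_iso]).

    It remains to pass from the chart to the minimal resolution. The resolution
    map is birational onto the surface, so it restricts to an isomorphism of
    principal open sets on which both directions are given by a single tuple of
    homogeneous polynomials and whose target lies in the chart
    ([birational_principal_iso]). Two such isomorphisms compose
    ([principal_iso_trans]). The density of all the open sets involved comes
    from the irreducibility of the resolution: it gives the density of the open
    set of the surface, and the second isomorphism carries the latter to the
    Weierstrass model ([principal_dense_trans]). *)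

(** * Homogeneous polynomials and graded maps *)

Definition cone (K : closedFieldType) (n : nat) (X : pset K n) : Prop :=
  forall v w, proj_eq v w -> X v -> X w.

Definition graded_map (K : closedFieldType) (n m : nat)
    (P : 'I_m.+1 -> {mpoly K[n.+1]}) : Prop :=
  exists d : nat, forall i, P i \is d.-homog.

Definition pullback (K : closedFieldType) (n m : nat)
    (P : 'I_m.+1 -> {mpoly K[n.+1]}) (q : {mpoly K[m.+1]}) : {mpoly K[n.+1]} :=
  q \mPo [tuple P i | i < m.+1].

Section Homogeneous.
Variables (K : closedFieldType) (n : nat).
Implicit Types (v w : 'rV[K]_n.+1) (p : {mpoly K[n.+1]}).

Lemma proj_eq_refl v : proj_eq v v.
Proof. by exists 1; rewrite ?oner_eq0 // scale1r. Qed.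

Lemma proj_eq_sym v w : proj_eq v w -> proj_eq w v.
Proof.
by case=> c c0 ->; exists c^-1; rewrite ?invr_eq0 // scalerA mulVf // scale1r.
Qed.

Lemma proj_eq_trans u v w : proj_eq u v -> proj_eq v w -> proj_eq u w.
Proof.
move=> [c c0 ->] [d d0 ->]; exists (d * c); first by rewrite mulf_neq0.
by rewrite scalerA.
Qed.

Lemma proj_eq_neq0 v w : proj_eq v w -> v != 0 -> w != 0.
Proof. by case=> c c0 -> v0; rewrite scaler_eq0 negb_or c0. Qed.

Lemma meval_homogZ d p c v : p \is d.-homog -> p.@[(c *: v) 0] = c ^+ d * p.@[v 0].
Proof.
move=> hp; rewrite !mevalE mulr_sumr; apply: eq_big_seq => m mp.
rewrite mulrCA; congr (_ * _).
have <- : mdeg m = d by exact: (dhomog_mf hp).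
rewrite mdegE -prodrXr -big_split /=; apply: eq_bigr => i _.
by rewrite mxE exprMn.
Qed.

Lemma homogeneous_neq0 p v w :
  homogeneous p -> proj_eq v w -> p.@[v 0] != 0 -> p.@[w 0] != 0.
Proof.
by move=> [d hp] [c c0 ->] pv; rewrite (meval_homogZ _ _ hp) mulf_neq0 ?expf_neq0.
Qed.

Lemma homogeneous_eq0 p v w :
  homogeneous p -> proj_eq v w -> p.@[v 0] = 0 -> p.@[w 0] = 0.
Proof. by move=> [d hp] [c c0 ->] pv; rewrite (meval_homogZ _ _ hp) pv mulr0. Qed.

Lemma homogeneousM p q : homogeneous p -> homogeneous q -> homogeneous (p * q).
Proof. by move=> [d hp] [e hq]; exists (d + e)%N; exact: dhomogM. Qed.

Lemma homogeneous1 : homogeneous (1 : {mpoly K[n.+1]}).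
Proof. by exists 0%N; exact: dhomog1. Qed.

Lemma homogeneousX i : homogeneous ('X_i : {mpoly K[n.+1]}).
Proof. by exists 1%N; rewrite dhomogX /= mdeg1. Qed.

Lemma zclosed_cone (X : pset K n) : zclosed X -> cone X.
Proof.
move=> [s [hs Xs]] v w vw /Xs [v0 sv]; apply/Xs; split.
  exact: (proj_eq_neq0 vw).
by move=> p ps; apply: (homogeneous_eq0 (hs _ ps) vw); exact: sv.
Qed.

Lemma zclosed_hypersurface p :
  homogeneous p -> zclosed (fun v : 'rV[K]_n.+1 => v != 0 /\ p.@[v 0] = 0).
Proof.
move=> hp; exists [:: p]; split=> [r|v]; first by rewrite inE => /eqP->.
split=> -[v0 pv]; split=> //; first by move=> r; rewrite inE => /eqP->.
by apply: pv; rewrite inE.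
Qed.

Lemma dhomog_pullback m d e (P : 'I_m.+1 -> {mpoly K[n.+1]}) (q : {mpoly K[m.+1]}) :
  (forall i, P i \is d.-homog) -> q \is e.-homog -> pullback P q \is (d * e).-homog.
Proof.
move=> hP hq.
rewrite /pullback comp_mpolyE big_seq rpred_sum // => r rq; apply: dhomogZ.
have <- : mdeg r = e by exact: (dhomog_mf hq).
rewrite mdegE big_distrr /=.
apply: (big_rec2 (fun (x : {mpoly K[n.+1]}) (y : nat) => x \is y.-homog)).
  exact: dhomog1.
by move=> i x y _ hx; apply: dhomogM => //; rewrite tnth_mktuple; exact: dhomogMn.
Qed.

Lemma homogeneous_pullback m (P : 'I_m.+1 -> {mpoly K[n.+1]}) (q : {mpoly K[m.+1]}) :
  graded_map P -> homogeneous q -> homogeneous (pullback P q).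
Proof. by move=> [d hP] [e hq]; exists (d * e)%N; exact: dhomog_pullback. Qed.

Lemma meval_pullback m (P : 'I_m.+1 -> {mpoly K[n.+1]}) (q : {mpoly K[m.+1]}) v :
  (pullback P q).@[v 0] = q.@[(eval_map P v) 0].
Proof.
rewrite /pullback comp_mpoly_meval; apply: meval_eq => i.
by rewrite tnth_mktuple mxE.
Qed.

Lemma eval_map_proj m (P : 'I_m.+1 -> {mpoly K[n.+1]}) v w :
  graded_map P -> proj_eq v w -> proj_eq (eval_map P v) (eval_map P w).
Proof.
move=> [d hP] [c c0 ->]; exists (c ^+ d); first exact: expf_neq0.
by apply/rowP=> i; rewrite !mxE (meval_homogZ _ _ (hP i)).
Qed.

End Homogeneous.

Lemma graded_map_comp (K : closedFieldType) (n m k : nat)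
    (P : 'I_m.+1 -> {mpoly K[n.+1]}) (Q : 'I_k.+1 -> {mpoly K[m.+1]}) :
  graded_map P -> graded_map Q -> graded_map (fun i => pullback P (Q i)).
Proof. by move=> [d hP] [e hQ]; exists (d * e)%N => i; exact: dhomog_pullback. Qed.

Lemma eval_map_comp (K : closedFieldType) (n m k : nat)
    (P : 'I_m.+1 -> {mpoly K[n.+1]}) (Q : 'I_k.+1 -> {mpoly K[m.+1]}) v :
  eval_map (fun i => pullback P (Q i)) v = eval_map Q (eval_map P v).
Proof. by apply/rowP=> i; rewrite mxE meval_pullback mxE. Qed.

(** * Principal open sets *)

Definition principal (K : closedFieldType) (n : nat) (X : pset K n)
    (p : {mpoly K[n.+1]}) : pset K n := fun v : 'rV[K]_n.+1 => X v /\ p.@[v 0] != 0.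

(** Density tested on hypersurfaces only, which suffices because every closed set
    is an intersection of hypersurfaces. *)
Definition principal_dense (K : closedFieldType) (n : nat) (X : pset K n)
    (p : {mpoly K[n.+1]}) : Prop :=
  forall r, homogeneous r -> (forall v : 'rV[K]_n.+1, principal X p v -> r.@[v 0] = 0) ->
    forall v : 'rV[K]_n.+1, X v -> r.@[v 0] = 0.

Section Principal.
Variables (K : closedFieldType) (n : nat) (X : pset K n).
Hypothesis X_neq0 : forall v, X v -> v != 0.
Implicit Types (v w : 'rV[K]_n.+1) (p r : {mpoly K[n.+1]}).

Lemma zopen_principal p : homogeneous p -> zopen_in X (principal X p).
Proof.
move=> hp; exists (fun v : 'rV[K]_n.+1 => v != 0 /\ p.@[v 0] = 0).
  exact: zclosed_hypersurface.
move=> v; split=> -[Xv pv]; split=> //; first by case=> _ /eqP; exact/negP.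
by apply/eqP=> pv0; apply: pv; split=> //; exact: X_neq0.
Qed.

(** A point off a closed set is off one of the finitely many hypersurfaces that
    cut it out. Shrinking to such a principal open set replaces all topological
    reasoning below by the evaluation of polynomials. *)
Lemma zopen_in_nbhs U v : zopen_in X U -> U v ->
  exists p, [/\ homogeneous p, p.@[v 0] != 0 & forall w, principal X p w -> U w].
Proof.
move=> [Z [s [hs Zs]] UZ] /UZ[Xv nZv].
have /allPn[p ps pv] : ~~ all (fun p : {mpoly K[n.+1]} => p.@[v 0] == 0) s.
  apply/negP=> /allP sv; apply/nZv/Zs; split; first exact: X_neq0.
  by move=> p /sv /eqP.
exists p; split=> //; first exact: hs.
move=> w [Xw pw]; apply/UZ; split=> // /Zs[_ /(_ p ps) /eqP]; exact/negP.
Qed.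

Lemma zopen_in_trans_nbhs U U' v : zopen_in X U -> zopen_in U U' -> U' v ->
  exists p, [/\ homogeneous p, p.@[v 0] != 0 & forall w, principal X p w -> U' w].
Proof.
move=> oU [Z cZ U'Z] U'v; have [Uv nZv] := (U'Z v).1 U'v.
have [p [hp pv pU]] := zopen_in_nbhs oU Uv.
have oXZ : zopen_in X (fun w => X w /\ ~ Z w) by exists Z.
have Xv : X v by case: oU Uv => Z' _ UZ' /UZ'[].
have [q [hq qv qZ]] := zopen_in_nbhs oXZ (conj Xv nZv).
exists (p * q); split; first exact: homogeneousM.
  by rewrite mevalM mulf_neq0.
move=> w [Xw]; rewrite mevalM mulf_eq0 negb_or => /andP[pw qw].
apply/U'Z; split; first exact: pU.
by have [] := qZ w (conj Xw qw).
Qed.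

(** If r vanishes where p does not, the hypersurfaces p = 0 and r = 0 cover X, so
    one of them contains X. *)
Lemma irreducible_principal_dense p : zirreducible X -> homogeneous p ->
  (exists v, principal X p v) -> principal_dense X p.
Proof.
move=> [_ irrX] hp [v [Xv pv]] r hr r0 w Xw.
have [|X_p|X_r] := irrX _ _ (zclosed_hypersurface hp) (zclosed_hypersurface hr).
- move=> u Xu; have u0 := X_neq0 Xu; have [pu|pu] := eqVneq (p.@[u 0]) 0.
    by left.
  by right; split=> //; exact: r0.
- by have [_ /eqP] := X_p v Xv; rewrite (negPf pv).
- by have [] := X_r w Xw.
Qed.

Lemma zdense_principal p : homogeneous p -> principal_dense X p ->
  zdense_in X (principal X p).
Proof.
move=> hp dp Z [s [hs Zs]] UZ v Xv; apply/Zs; split; first exact: X_neq0.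
move=> r rs; apply: dp => // [|w /UZ /Zs[_]]; [exact: hs | exact].
Qed.

End Principal.

(** * Birational maps with polynomial data *)

(** Mutually inverse isomorphisms between the locus p <> 0 of X and the locus
    q <> 0 of Y, each given by one tuple of forms on its whole domain. *)
Definition principal_iso (K : closedFieldType) (n m : nat) (X : pset K n) (Y : pset K m)
    (p : {mpoly K[n.+1]}) (q : {mpoly K[m.+1]})
    (P : 'I_m.+1 -> {mpoly K[n.+1]}) (Q : 'I_n.+1 -> {mpoly K[m.+1]}) : Prop :=
  [/\ [/\ homogeneous p, homogeneous q, graded_map P & graded_map Q],
      forall v, principal X p v ->
        principal Y q (eval_map P v) /\ proj_eq v (eval_map Q (eval_map P v)) &
      forall w, principal Y q w ->
        principal X p (eval_map Q w) /\ proj_eq w (eval_map P (eval_map Q w))].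

Lemma regular_map_principal (K : closedFieldType) (n m : nat) (X : pset K n)
    (Y : pset K m) p (P : 'I_m.+1 -> {mpoly K[n.+1]}) :
    (forall v, X v -> v != 0) -> (forall w, Y w -> w != 0) -> graded_map P ->
    (forall v, principal X p v -> Y (eval_map P v)) ->
  regular_map (principal X p) Y (eval_map P).
Proof.
move=> X_neq0 Y_neq0 [d hP] PY; split=> // v pv.
exists (principal (principal X p) 1); split.
  by apply: zopen_principal (homogeneous1 _ _) => w [/X_neq0].
split; first by split=> //; rewrite meval1 oner_neq0.
exists d, P; split=> // w [pw _]; split; first exact/Y_neq0/PY.
exact: proj_eq_refl.
Qed.

Lemma principal_iso_birational (K : closedFieldType) (n m : nat) (X : pset K n)
    (Y : pset K m) p q P Q :
    (forall v, X v -> v != 0) -> (forall w, Y w -> w != 0) ->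
    principal_iso X Y p q P Q -> principal_dense X p -> principal_dense Y q ->
  birational X Y.
Proof.
move=> X_neq0 Y_neq0 [[hp hq hP hQ] PK QK] dX dY.
exists (principal X p), (principal Y q), (eval_map P), (eval_map Q); split.
- exact: zopen_principal.
- exact: zdense_principal.
- exact: zopen_principal.
- exact: zdense_principal.
- split.
  + by apply: regular_map_principal => // [w [/Y_neq0]|v /PK[]].
  + by apply: regular_map_principal => // [w [/X_neq0]|v /QK[]].
  + by move=> v /PK[].
  + by move=> w /QK[].
Qed.

(** Fix a point w0 of V where l does not vanish and its preimage v0. Near v0 the map
    f is given by forms P, near w0 the map g is given by forms Q. Let p0 and q0 be
    forms that are nonzero at v0 and w0 and cut out neighbourhoods on which these
    expressions are valid. The locus p0 <> 0, q0 (P) <> 0, l (P) <> 0 of X and the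
    locus q0 <> 0, l <> 0, p0 (Q) <> 0 of Y then correspond to each other. The
    second one is dense in Y because the first one is dense in X, by
    irreducibility, and f carries this density to V. *)
Lemma birational_principal_iso (K : closedFieldType) (n m : nat) (X : pset K n)
    (Y : pset K m) (l : {mpoly K[m.+1]}) :
    (forall v, X v -> v != 0) -> (forall w, Y w -> w != 0) -> cone X -> cone Y ->
    zirreducible X -> birational X Y -> homogeneous l ->
    (exists2 w : 'rV[K]_m.+1, Y w & l.@[w 0] != 0) ->
  exists p q P Q, [/\ principal_iso X Y p q P Q,
    forall w, principal Y q w -> l.@[w 0] != 0,
    exists v, principal X p v & principal_dense Y q].
Proof.
move=> X_neq0 Y_neq0 cX cY irrX
  [U [V [f [g [oU dU oV dV [[fUV rf] [gVU rg] gfK fgK]]]]]] hl [w1 Yw1 lw1].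
have UX v : U v -> X v by case: oU => Z _ UZ /UZ[].
have VY w : V w -> Y w by case: oV => Z _ VZ /VZ[].
(* Otherwise the dense set V would lie in the hypersurface l = 0. *)
have [w0 Vw0 lw0] : exists2 w, V w & l.@[w 0] != 0.
  apply: boolp.contrapT => nV.
  have lV w : V w -> w != 0 /\ l.@[w 0] = 0.
    move=> Vw; split; first exact/Y_neq0/VY.
    by apply/eqP; apply: contraT => lw; case: nV; exists w.
  by have [_ /eqP] := dV _ (zclosed_hypersurface hl) lV _ Yw1; rewrite (negPf lw1).
have Uv0 := gVU w0 Vw0; set v0 := g w0 in Uv0.
have fv0 : proj_eq w0 (f v0) := fgK w0 Vw0.
have [U0 [oU0 [U0v0 [d [P [hP fP]]]]]] := rf v0 Uv0.
have [V0 [oV0 [V0w0 [e [Q [hQ gQ]]]]]] := rg w0 Vw0.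
have gP : graded_map P by exists d.
have gQ' : graded_map Q by exists e.
have [p0 [hp0 p0v0 p0U]] := zopen_in_trans_nbhs X_neq0 oU oU0 U0v0.
have [q0 [hq0 q0w0 q0V]] := zopen_in_trans_nbhs Y_neq0 oV oV0 V0w0.
have U0U v : U0 v -> U v by case: oU0 => Z _ UZ /UZ[].
have V0V w : V0 w -> V w by case: oV0 => Z _ VZ /VZ[].
have fPp v : U0 v -> proj_eq (f v) (eval_map P v) by move=> /fP[].
have gQp w : V0 w -> proj_eq (g w) (eval_map Q w) by move=> /gQ[].
have hlP := homogeneous_pullback gP hl.
have hqP := homogeneous_pullback gP hq0.
have hpQ := homogeneous_pullback gQ' hp0.
have hp : homogeneous (p0 * (pullback P q0 * pullback P l)).
  by do 2?apply: homogeneousM.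
have hq : homogeneous (q0 * (l * pullback Q p0)) by do 2?apply: homogeneousM.
have ne : principal X (p0 * (pullback P q0 * pullback P l)) v0.
  split; first exact: UX.
  rewrite !mevalM !meval_pullback !mulf_neq0 //.
    exact: (homogeneous_neq0 hq0 (proj_eq_trans fv0 (fPp _ U0v0))).
  exact: (homogeneous_neq0 hl (proj_eq_trans fv0 (fPp _ U0v0))).
have pP v : principal X (p0 * (pullback P q0 * pullback P l)) v ->
    principal Y (q0 * (l * pullback Q p0)) (eval_map P v) /\
    proj_eq v (eval_map Q (eval_map P v)).
  move=> [Xv]; rewrite !mevalM !meval_pullback !mulf_eq0 !negb_or.
  move=> /and3P[pv qPv lPv].
  have U0v := p0U _ (conj Xv pv); have Uv := U0U _ U0v.
  have Vfv := fUV _ Uv; have fPv := fPp _ U0v.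
  have YPv := cY _ _ fPv (VY _ Vfv).
  have V0fv : V0 (f v).
    by apply: q0V; split; [exact: VY | exact: homogeneous_neq0 (proj_eq_sym fPv) qPv].
  have QPv : proj_eq v (eval_map Q (eval_map P v)).
    apply: proj_eq_trans (gfK _ Uv) (proj_eq_trans (gQp _ V0fv) _).
    exact: eval_map_proj.
  split=> //; split=> //; rewrite !mevalM !meval_pullback !mulf_neq0 //.
  exact: homogeneous_neq0 QPv pv.
have qQ w : principal Y (q0 * (l * pullback Q p0)) w ->
    principal X (p0 * (pullback P q0 * pullback P l)) (eval_map Q w) /\
    proj_eq w (eval_map P (eval_map Q w)).
  move=> [Yw]; rewrite !mevalM !meval_pullback !mulf_eq0 !negb_or.
  move=> /and3P[qw lw pQw].
  have V0w := q0V _ (conj Yw qw); have Vw := V0V _ V0w.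
  have Ugw := gVU _ Vw; have gQw := gQp _ V0w.
  have XQw := cX _ _ gQw (UX _ Ugw).
  have U0gw : U0 (g w).
    by apply: p0U; split; [exact: UX | exact: homogeneous_neq0 (proj_eq_sym gQw) pQw].
  have PQw : proj_eq w (eval_map P (eval_map Q w)).
    apply: proj_eq_trans (fgK _ Vw) (proj_eq_trans (fPp _ U0gw) _).
    exact: eval_map_proj.
  split=> //; split=> //; rewrite !mevalM !meval_pullback !mulf_neq0 //.
    exact: homogeneous_neq0 PQw qw.
  exact: homogeneous_neq0 PQw lw.
exists (p0 * (pullback P q0 * pullback P l)), (q0 * (l * pullback Q p0)), P, Q.
split=> //; last 2 first.
- by exists v0.
- move=> r hr r0.
  suff rV w : V w -> w != 0 /\ r.@[w 0] = 0.
    by move=> w Yw; have [] := dV _ (zclosed_hypersurface hr) rV w Yw.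
  (* Near g w the map f is given by forms P', valid where p' <> 0. The form
     p' * r (P') vanishes on the principal open set of X, since P and P' agree
     up to scaling where both are valid; hence it vanishes at g w, and there
     p' is nonzero while P' represents w. *)
  move=> Vw; split; first exact/Y_neq0/VY.
  have [U' [oU' [U'v [d' [P' [hP' fP']]]]]] := rf (g w) (gVU _ Vw).
  have gP' : graded_map P' by exists d'.
  have [p' [hp' p'v p'U]] := zopen_in_trans_nbhs X_neq0 oU oU' U'v.
  have := irreducible_principal_dense X_neq0 irrX hp (ex_intro _ v0 ne)
    (homogeneousM hp' (homogeneous_pullback gP' hr)).
  move=> /(_ _ (g w) (UX _ (gVU _ Vw))); rewrite mevalM meval_pullback.
  move=> H; have {H}/eqP : p'.@[g w 0] * r.@[eval_map P' (g w) 0] = 0.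
    apply: H => v pv; have [Xv pv0] := pv.
    rewrite mevalM meval_pullback; have [->|p'v'] := eqVneq (p'.@[v 0]) 0.
      by rewrite mul0r.
    have U'v' := p'U _ (conj Xv p'v').
    have U0v : U0 v.
      by apply: p0U; split=> //; move: pv0; rewrite mevalM mulf_eq0 negb_or => /andP[].
    have [_ fv'] := fP' _ U'v'.
    rewrite (homogeneous_eq0 hr (proj_eq_trans (proj_eq_sym (fPp _ U0v)) fv')) ?mulr0 //.
    by apply: r0; have [] := pP _ pv.
  rewrite mulf_eq0 (negPf p'v) /= => /eqP rw.
  have [_ fgw] := fP' _ U'v.
  exact: homogeneous_eq0 (proj_eq_sym (proj_eq_trans (fgK _ Vw) fgw)) rw.
- by move=> w [_]; rewrite !mevalM !mulf_eq0 !negb_or => /and3P[].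
Qed.

(** The forms S and T are evaluated at representatives produced by P and Q, which
    is harmless since forms respect proportionality. *)
Lemma principal_iso_trans (K : closedFieldType) (n m k : nat)
    (X : pset K n) (Y : pset K m) (W : pset K k) p q P Q l r S T :
    principal_iso X Y p q P Q -> principal_iso Y W l r S T ->
    (forall w, principal Y q w -> l.@[w 0] != 0) ->
  principal_iso X W p (r * pullback T q) (fun i => pullback P (S i))
    (fun i => pullback T (Q i)).
Proof.
move=> [[hp hq hP hQ] PK QK] [[hl hr hS hT] SK TK] ql.
split.
- split=> //; [|exact: graded_map_comp|exact: graded_map_comp].
  by apply: homogeneousM => //; exact: homogeneous_pullback.
- move=> v /PK[qPv Pv]; rewrite !eval_map_comp.
  have lPv : principal Y l (eval_map P v) by split; [case: qPv | exact: ql].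
  have [rSv Sv] := SK _ lPv.
  split; last by apply: proj_eq_trans Pv _; apply: eval_map_proj.
  case: rSv => WSv rSv; split=> //.
  rewrite mevalM mulf_neq0 // meval_pullback.
  by apply: homogeneous_neq0 hq Sv _; case: qPv.
- move=> w [Ww]; rewrite mevalM mulf_eq0 negb_or meval_pullback => /andP[rw qTw].
  have [[YTw lTw] Tw] := TK w (conj Ww rw); rewrite !eval_map_comp.
  have [pQw Qw] := QK _ (conj YTw qTw); split=> //.
  by apply: proj_eq_trans Tw _; apply: eval_map_proj.
Qed.

(** A form vanishing on the open set of W pulls back along S to a form vanishing on
    the locus q <> 0 of Y, hence on Y; pulling back along T returns it to W. *)
Lemma principal_dense_trans (K : closedFieldType) (m k : nat)
    (Y : pset K m) (W : pset K k) q l r S T :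
    homogeneous q -> principal_iso Y W l r S T ->
    (forall w, principal Y q w -> l.@[w 0] != 0) ->
    principal_dense Y q -> principal_dense W r ->
  principal_dense W (r * pullback T q).
Proof.
move=> hq [[hl hr hS hT] SK TK] ql dY dW t ht t0; apply: dW => // w [Ww rw].
have [[YTw lTw] Tw] := TK w (conj Ww rw).
apply: (homogeneous_eq0 ht (proj_eq_sym Tw)).
rewrite -meval_pullback; apply: dY => //; first exact: homogeneous_pullback.
move=> y qy; rewrite meval_pullback; have [Yy qy'] := qy.
have [[WSy rSy] Sy] := SK y (conj Yy (ql _ qy)).
apply: t0; split=> //; rewrite mevalM mulf_neq0 // meval_pullback.
exact: homogeneous_neq0 Sy _.
Qed.
(** * The chart of the scroll *)

Section Vinberg.
Variables (K : numClosedFieldType) (a a1 a2 b b1 b2 f1 f2 g1 g2 h : K).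

Let Y : pset K 5 := vinberg_surface a a1 a2 b b1 b2 f1 f2 g1 g2 h.

Definition vinberg_weierstrass : pset K 3 :=
  weierstrass_model
    (- (3 / 2) * a2) (- (3 / 2) * f2)
    (f1 + 3 / 4 * a2 ^+ 2) (a1 + 3 / 2 * a2 * f2) (a + 3 / 4 * f2 ^+ 2)
    (b2 - 1 / 4 * a2 ^+ 2) (g2 - 1 / 2 * a2 * f2)
    (h - 1 / 2 * a2 * f1 - 1 / 4 * f2 ^+ 2 - 1 / 8 * a2 ^+ 3)
    (g1 - 1 / 2 * (a2 * a1 + f2 * f1) - 3 / 8 * a2 ^+ 2 * f2)
    (b1 - 1 / 2 * (a2 * a + f2 * a1) - 3 / 8 * a2 * f2 ^+ 2)
    (b - 1 / 2 * f2 * a - 1 / 8 * f2 ^+ 3).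

Let W := vinberg_weierstrass.

(** The point (x, y, u) of the affine model with u = z / y1,
    x = x1 / y1 + (a2 u + f2) / 2 and y = - i x0 / y1, with denominators cleared
    by y1. *)
Definition vinberg_to_weierstrass : 'I_4 -> {mpoly K[6]} := fun i =>
  [:: 'X_3; 'X_1 + (a2 / 2) *: 'X_5 + (f2 / 2) *: 'X_3; (- 'i) *: 'X_0; 'X_5]`_i.

(** The inverse substitution in degree 2, where x1 is the linear form
    x - (a2 u + f2) / 2 homogenised. *)
Definition weierstrass_to_vinberg : 'I_6 -> {mpoly K[4]} := fun i =>
  let x1 := 'X_1 - (a2 / 2) *: 'X_3 - (f2 / 2) *: 'X_0 in
  [:: 'i *: ('X_2 * 'X_0); x1 * 'X_0; 'X_3 * x1;
      'X_0 * 'X_0; 'X_3 * 'X_3; 'X_3 * 'X_0]`_i.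

Lemma vinberg_to_weierstrass_graded : graded_map vinberg_to_weierstrass.
Proof.
exists 1%N; case=> [[|[|[|[|i]]]] hi] //=; rewrite /vinberg_to_weierstrass /=;
by repeat first [apply: dhomogD | apply: dhomogZ | rewrite dhomogX /= mdeg1].
Qed.

Lemma weierstrass_to_vinberg_graded : graded_map weierstrass_to_vinberg.
Proof.
have h1 : 'X_1 - (a2 / 2) *: 'X_3 - (f2 / 2) *: 'X_0 \is [in K[4], 1.-homog].
  by rewrite !rpredB ?dhomogZ ?dhomogX //= mdeg1.
exists 2; case=> [[|[|[|[|[|[|i]]]]]] hi] //=; rewrite /weierstrass_to_vinberg /=;
by repeat first [apply: dhomogZ | exact: h1 | rewrite dhomogX /= mdeg1
  | apply: (@dhomogM _ _ _ 1 _ 1)].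
Qed.

Definition weierstrass_row (t x y u : K) : 'rV[K]_4 := \row_i [:: t; x; y; u]`_i.
Definition scroll_row (x0 x1 x2 y1 y2 z : K) : 'rV[K]_6 :=
  \row_i [:: x0; x1; x2; y1; y2; z]`_i.

Lemma weierstrass_row_eta (w : 'rV[K]_4) :
  weierstrass_row (w 0 0) (w 0 1) (w 0 2) (w 0 3) = w.
Proof.
apply/rowP => i; rewrite mxE.
by case: i => [[|[|[|[|i]]]] hi] //=; congr (w _ _); exact: val_inj.
Qed.

Lemma weierstrass_rowZ c t x y u :
  c *: weierstrass_row t x y u = weierstrass_row (c * t) (c * x) (c * y) (c * u).
Proof. by apply/rowP => i; rewrite !mxE; case: i => [[|[|[|[|i]]]] hi]. Qed.

Lemma scroll_row_eta (v : 'rV[K]_6) :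
  scroll_row (v 0 0) (v 0 1) (v 0 2) (v 0 3) (v 0 4) (v 0 5) = v.
Proof.
apply/rowP => i; rewrite mxE.
by case: i => [[|[|[|[|[|[|i]]]]]] hi] //=; congr (v _ _); exact: val_inj.
Qed.

Lemma scroll_rowZ c x0 x1 x2 y1 y2 z : c *: scroll_row x0 x1 x2 y1 y2 z =
  scroll_row (c * x0) (c * x1) (c * x2) (c * y1) (c * y2) (c * z).
Proof. by apply/rowP => i; rewrite !mxE; case: i => [[|[|[|[|[|[|i]]]]]] hi]. Qed.

Lemma vinberg_to_weierstrassE v : eval_map vinberg_to_weierstrass v =
  weierstrass_row (v 0 3) (v 0 1 + a2 / 2 * v 0 5 + f2 / 2 * v 0 3)
    (- 'i * v 0 0) (v 0 5).
Proof.
apply/rowP => i; rewrite !mxE /vinberg_to_weierstrass.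
by case: i => [[|[|[|[|i]]]] hi] //=; rewrite ?(mevalD, mevalZ, mevalXU).
Qed.

Lemma weierstrass_to_vinbergE w : eval_map weierstrass_to_vinberg w =
  let x1 := w 0 1 - a2 / 2 * w 0 3 - f2 / 2 * w 0 0 in
  scroll_row ('i * (w 0 2 * w 0 0)) (x1 * w 0 0) (w 0 3 * x1)
    (w 0 0 * w 0 0) (w 0 3 * w 0 3) (w 0 3 * w 0 0).
Proof.
apply/rowP => i; rewrite !mxE /weierstrass_to_vinberg.
by case: i => [[|[|[|[|[|[|i]]]]]] hi] //=;
  rewrite ?(mevalB, mevalM, mevalZ, mevalXU).
Qed.

(** Vinberg's cubic at the point (x0, x1, u x1, 1, u^2, u) of the scroll. *)
Definition vinberg_affine (x0 x1 u : K) : K :=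
  x0 ^+ 2 + x1 ^+ 3 + u ^+ 3 * x1 ^+ 2
  + (a2 * u ^+ 4 + f2 * u ^+ 3 + f1 * u ^+ 2 + a1 * u + a) * x1
  + b2 * u ^+ 5 + g2 * u ^+ 4 + h * u ^+ 3 + g1 * u ^+ 2 + b1 * u + b.

(** On the scroll Vinberg's cubic is y1^3 times its affine form and the satellite
    cubic is y1^2 z times it, so on the chart the satellite adds no condition. *)
Lemma vinberg_surfaceE (v : 'rV[K]_6) : v 0 3 != 0 ->
  Y v <-> [/\ v 0 2 = v 0 1 * (v 0 5 / v 0 3), v 0 4 = v 0 3 * (v 0 5 / v 0 3) ^+ 2 &
     vinberg_affine (v 0 0 / v 0 3) (v 0 1 / v 0 3) (v 0 5 / v 0 3) = 0].
Proof.
move=> y1; rewrite /Y /vinberg_surface /scroll /vinberg_cubic /satellite_cubic.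
have v0 : v != 0 by apply: contraNneq y1 => ->; rewrite mxE.
rewrite /vinberg_affine; move: y1.
set x0 := v 0 0; set x1 := v 0 1; set x2 := v 0 2.
set y1 := v 0 3; set y2 := v 0 4; set z := v 0 5 => y1_neq0.
split=> [[[_ e1 e2 e3] eF _]|[ex2 ey2 eaff]].
  have ex2 : x2 = x1 * (z / y1).
    by apply: (mulIf y1_neq0); rewrite (subr0_eq e1); field.
  have ey2 : y2 = y1 * (z / y1) ^+ 2.
    by apply: (mulIf y1_neq0); rewrite mulrC (subr0_eq e3); field.
  split=> //; apply: (mulfI (expf_neq0 3 y1_neq0)); rewrite mulr0 -[RHS]eF ex2 ey2.
  by field.
split; first split=> //; rewrite ?ex2 ?ey2; try by field.
- by rewrite -[RHS](mulr0 (y1 ^+ 3)) -[in RHS]eaff; field.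
- by rewrite -[RHS](mulr0 (y1 ^+ 2 * z)) -[in RHS]eaff; field.
Qed.

(** Here the formulas for the Weierstrass coefficients enter: this is the change of
    variables x0 = i y, x1 = x - (a2 u + f2) / 2. *)
Lemma weierstrassE (w : 'rV[K]_4) : W w <-> w 0 0 != 0 /\
  vinberg_affine ('i * (w 0 2 / w 0 0))
    (w 0 1 / w 0 0 - a2 / 2 * (w 0 3 / w 0 0) - f2 / 2) (w 0 3 / w 0 0) = 0.
Proof.
rewrite /W /vinberg_weierstrass /weierstrass_model /affine_chart !mxE.
have -> : lift ord0 (0 : 'I_3) = 1 :> 'I_4 by exact: val_inj.
have -> : lift ord0 (1 : 'I_3) = 2 :> 'I_4 by exact: val_inj.
have -> : lift ord0 (2 : 'I_3) = 3 :> 'I_4 by exact: val_inj.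
set x := w 0 1 / _; set y := w 0 2 / _; set u := w 0 3 / _.
rewrite /vinberg_affine; have -> : ('i * y) ^+ 2 = - y ^+ 2 by rewrite exprMn sqrCi mulN1r.
split=> -[w0 e]; split=> //.
  by rewrite e; field.
by apply/eqP; rewrite -subr_eq0 -oppr_eq0 -[X in _ == X]e; apply/eqP; field.
Qed.

Lemma vinberg_surface_neq0 v : Y v -> v != 0.
Proof. by case=> -[]. Qed.

Lemma weierstrass_neq0 w : W w -> w != 0.
Proof. by case=> w0 _; apply: contraNneq w0 => ->; rewrite mxE. Qed.

Lemma vinberg_surface_cone : cone Y.
Proof.
move=> v _ [c c0 ->] [[v0 e1 e2 e3] eF eG]; split; first split.
- by rewrite scaler_eq0 negb_or c0.
- by rewrite !mxE -[RHS](mulr0 (c ^+ 2)) -[in RHS]e1; ring.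
- by rewrite !mxE -[RHS](mulr0 (c ^+ 2)) -[in RHS]e2; ring.
- by rewrite !mxE -[RHS](mulr0 (c ^+ 2)) -[in RHS]e3; ring.
- by rewrite /vinberg_cubic !mxE -[RHS](mulr0 (c ^+ 3)) -[in RHS]eF /vinberg_cubic; ring.
- by rewrite /satellite_cubic !mxE -[RHS](mulr0 (c ^+ 3)) -[in RHS]eG /satellite_cubic; ring.
Qed.

(** At x1 = u = 0 the affine equation reduces to x0^2 = - b. *)
Lemma vinberg_surface_meets_chart : exists2 v : 'rV[K]_6, Y v & v 0 3 != 0.
Proof.
have e3 : scroll_row ('i * sqrtC b) 0 0 1 0 0 0 3 = 1 by rewrite mxE.
exists (scroll_row ('i * sqrtC b) 0 0 1 0 0); last by rewrite e3 oner_eq0.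
apply/vinberg_surfaceE; first by rewrite e3 oner_eq0.
rewrite !mxE /= /vinberg_affine; split; rewrite ?(mul0r, expr0n, mulr0) //=.
by rewrite divr1 exprMn sqrCi sqrtCK !(mulr0, mul0r, addr0); ring.
Qed.

Lemma vinberg_weierstrass_iso : principal_iso Y W 'X_3 'X_0
  vinberg_to_weierstrass weierstrass_to_vinberg.
Proof.
split.
- split; [exact: homogeneousX | exact: homogeneousX
    | exact: vinberg_to_weierstrass_graded | exact: weierstrass_to_vinberg_graded].
- move=> v [Yv]; rewrite mevalXU => y1; have [ex2 ey2 eaff] := (vinberg_surfaceE y1).1 Yv.
  rewrite weierstrass_to_vinbergE vinberg_to_weierstrassE; split; first split.
  + apply/weierstrassE; rewrite !mxE /=; split=> //; rewrite -[RHS]eaff.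
    congr (vinberg_affine _ _ _); last by field.
    by rewrite mulrA mulrA mulrN -expr2 sqrCi opprK mul1r.
  + by rewrite mevalXU mxE.
  + exists (v 0 3) => //; rewrite -[v in _ *: v]scroll_row_eta scroll_rowZ !mxE /=.
    have ii (s t : K) : 'i * (- 'i * s * t) = s * t.
      by rewrite !mulrA mulrN -expr2 sqrCi opprK mul1r.
    rewrite ex2 ey2 ii; congr scroll_row; by field.
- move=> w [Ww _]; have [w0 eaff] := (weierstrassE w).1 Ww.
  rewrite vinberg_to_weierstrassE weierstrass_to_vinbergE; split; first split.
  + apply/vinberg_surfaceE; rewrite !mxE /=; first by rewrite mulf_neq0.
    split; [by field|by field|].
    by rewrite -[RHS]eaff; congr (vinberg_affine _ _ _); field.
  + by rewrite mevalXU mxE /= mulf_neq0.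
  + exists (w 0 0) => //.
    rewrite -[w in _ *: w]weierstrass_row_eta weierstrass_rowZ !mxE /=.
    have ii (t : K) : - 'i * ('i * t) = t by rewrite mulrA mulNr -expr2 sqrCi opprK mul1r.
    rewrite ii; congr weierstrass_row; by field.
Qed.

End Vinberg.

Theorem proposition4p1 (R : realType)
    (a a1 a2 b b1 b2 f1 f2 g1 g2 h : R[i])
    (n : nat) (Ymin : pset R[i] n) (pi : 'rV[R[i]]_n.+1 -> 'rV[R[i]]_6)
    (Ymin_res : minimal_resolution
                  (vinberg_surface a a1 a2 b b1 b2 f1 f2 g1 g2 h) Ymin pi)
    (Ymin_K3 : K3_surface Ymin) :
  let F4 := - (3 / 2) * a2 in
  let F6 := - (3 / 2) * f2 in
  let G8 := f1 + 3 / 4 * a2 ^+ 2 in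
  let G10 := a1 + 3 / 2 * a2 * f2 in
  let G12 := a + 3 / 4 * f2 ^+ 2 in
  let H8 := b2 - 1 / 4 * a2 ^+ 2 in
  let H10 := g2 - 1 / 2 * a2 * f2 in
  let H12 := h - 1 / 2 * a2 * f1 - 1 / 4 * f2 ^+ 2 - 1 / 8 * a2 ^+ 3 in
  let H14 := g1 - 1 / 2 * (a2 * a1 + f2 * f1) - 3 / 8 * a2 ^+ 2 * f2 in
  let H16 := b1 - 1 / 2 * (a2 * a + f2 * a1) - 3 / 8 * a2 * f2 ^+ 2 in
  let H18 := b - 1 / 2 * f2 * a - 1 / 8 * f2 ^+ 3 in
  birational Ymin (weierstrass_model F4 F6 G8 G10 G12 H8 H10 H12 H14 H16 H18) /\
  H8 = - (1 / 4) * (a2 ^+ 2 - 4 * b2).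
Proof.
move=> F4 F6 G8 G10 G12 H8 H10 H12 H14 H16 H18; split; last by rewrite /H8; field.
pose Y := vinberg_surface a a1 a2 b b1 b2 f1 f2 g1 g2 h.
have [[_ [_ [U [V [g UVg]]]]] _] := Ymin_res.
have bir : birational Ymin Y by exists U, V, pi, g.
have [[[closedX irrX] _ _] _ _] := Ymin_K3.
have X_neq0 v : Ymin v -> v != 0 by case: closedX => s [_ Xs] /Xs[].
have Y_neq0 := @vinberg_surface_neq0 _ a a1 a2 b b1 b2 f1 f2 g1 g2 h.
have W_neq0 := @weierstrass_neq0 _ a a1 a2 b b1 b2 f1 f2 g1 g2 h.
have [|p [q [P [Q [isoXY ql neX dY]]]]] := birational_principal_iso X_neq0 Y_neq0
  (zclosed_cone closedX) (@vinberg_surface_cone _ a a1 a2 b b1 b2 f1 f2 g1 g2 h)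
  irrX bir (homogeneousX _ 3).
  have [v Yv v3] := vinberg_surface_meets_chart a a1 a2 b b1 b2 f1 f2 g1 g2 h.
  by exists v => //; rewrite mevalXU.
have isoYW := vinberg_weierstrass_iso a a1 a2 b b1 b2 f1 f2 g1 g2 h.
have [[hp hq _ _] _ _] := isoXY.
apply: (principal_iso_birational X_neq0 W_neq0 (principal_iso_trans isoXY isoYW ql)).
  exact: irreducible_principal_dense.
apply: (principal_dense_trans hq isoYW ql dY) => r _ r0 w Ww.
by apply: r0; split=> //; rewrite mevalXU; case: Ww.
Qed.
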